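(* Let $1\le p\le n-1$ and let $S\in\{RQ_p(n),\,I(n,p)\}$. Then: (a) if $\rho,\sigma\in S$ are of common height $q\ge 1$ (so $q=p$, with $\rho,\sigma$ nonzero, when $S=RQ_p(n)$, and $1\le q\le p$ when $S=I(n,p)$), written as $$\rho=\begin{pmatrix}A_1&\cdots&A_q\\ a_1&\cdots&a_q\end{pmatrix},\qquad \sigma=\begin{pmatrix}B_1&\cdots&B_q\\ b_1&\cdots&b_q\end{pmatrix},$$ then $(\rho,\sigma)\in\mathcal{L}$ in $S$ if and only if $a_i=b_i$ and $\min a_i\rho^{-1}=\min b_i\sigma^{-1}$ for all $i\in\{1,\dots,q\}$; (b) $S$ is $\mathcal{R}$-trivial (that is, $\mathcal{R}$ is the equality relation on $S$); (c) $\mathcal{L}=\mathcal{D}$ on $S$; (d) $\mathcal{R}=\mathcal{H}$ on $S$. Consequently, the semigroup $S$ is non-regular for $p\ge 2$.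
   Context: Let $[n]=\{1,\dots,n\}$ with its usual order. A partial transformation of $[n]$ is a function $\rho$ whose domain $\mathrm{Dom}\,\rho$ and image $\mathrm{Im}\,\rho$ are subsets of $[n]$ (the empty map is allowed). Maps are written on the right and composed left to right: $x(\rho\sigma)=(x\rho)\sigma$. $\rho$ is isotone if $x\le y$ implies $x\rho\le y\rho$ for all $x,y\in\mathrm{Dom}\,\rho$; antitone if $x\le y$ implies $x\rho\ge y\rho$; monotone if isotone or antitone; decreasing if $x\rho\le x$ for all $x\in\mathrm{Dom}\,\rho$. $\mathcal{DORP}_n$ is the monoid, under composition, of all monotone and decreasing partial transformations of $[n]$. The height of $\rho$ is $|\mathrm{Im}\,\rho|$. For $0\le p\le n-1$, $I(n,p)=\{\rho\in\mathcal{DORP}_n:|\mathrm{Im}\,\rho|\le p\}$, a two-sided ideal of $\mathcal{DORP}_n$. For $p\ge 1$, $RQ_p(n)=I(n,p)/I(n,p-1)$ is the Rees quotient: its nonzero elements are the elements of $\mathcal{DORP}_n$ of height exactly $p$, and a product of two of them is their composite if that has height $p$ and is the zero $\mathbf{0}$ otherwise. In two-line notation, $A_1<\cdots<A_q$ are the classes of the kernel relation $\{(x,y)\in\mathrm{Dom}\,\rho\times\mathrm{Dom}\,\rho:x\rho=y\rho\}$, listed in increasing order, and $a_i$ is the common image of the elements of $A_i$; similarly for $\sigma$. $a\rho^{-1}$ is the preimage of $a$. $\mathcal{L},\mathcal{R},\mathcal{H},\mathcal{D}$ are the usual Green's relations of $S$ ($\mathcal{D}$ is the join of $\mathcal{L}$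 and $\mathcal{R}$, $\mathcal{H}=\mathcal{L}\cap\mathcal{R}$). A semigroup $S$ is regular if for every $x\in S$ there is $y\in S$ with $x=xyx$. *)

(* Defs.v *)
From HB Require Import structures.
From mathcomp Require Import all_boot.
From Stdlib Require Import Relation_Operators.

Set Implicit Arguments.
Unset Strict Implicit.
Unset Printing Implicit Defensive.

Local Open Scope group_scope.

Section Green.

Variable S : semigroupType.
Implicit Types x y z : S.

(* in_lideal x z : z \in S^1 x, and in_rideal x z : z \in x S^1, where S^1 is S
   with an identity adjoined. *)
Definition in_lideal x z : Prop := z = x \/ exists s, z = s * x.
Definition in_rideal x z : Prop := z = x \/ exists s, z = x * s.

Definition greenL x y : Prop := forall z, in_lideal x z <-> in_lideal y z.
Definition greenR x y : Prop := forall z, in_rideal x z <-> in_rideal y z.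
Definition greenH x y : Prop := greenL x y /\ greenR x y.

(* The join of L and R in the lattice of equivalence relations on S. *)
Definition greenD : S -> S -> Prop :=
  clos_refl_sym_trans S (fun x y => greenL x y \/ greenR x y).

End Green.

Definition regular (S : semigroupType) : Prop :=
  forall x : S, exists y : S, x = x * y * x.

(* The chain {1 < ... < n} is represented by 'I_n = {0 < ... < n-1}. *)
Definition ptrans (n : nat) := {ffun 'I_n -> option 'I_n}.

Section PartialTransformations.

Variable n : nat.
Implicit Types (rho sigma tau : ptrans n) (x y a b m : 'I_n) (A : {set 'I_n}).

Definition Dom rho : {set 'I_n} := [set x | rho x != None].
(* fiber rho a is the preimage a rho^-1. *)
Definition fiber rho a : {set 'I_n} := [set x | rho x == Some a].
Definition Im rho : {set 'I_n} := [set a | [exists x, rho x == Some a]].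
Definition height rho : nat := #|Im rho|.

(* Maps act on the right: x (rho sigma) = (x rho) sigma. *)
Definition pcomp rho sigma : ptrans n := [ffun x => obind sigma (rho x)].
Definition pid : ptrans n := [ffun x => Some x].

Definition isotone rho : bool :=
  [forall x : 'I_n, forall y : 'I_n, forall a : 'I_n, forall b : 'I_n,
    [&& x <= y, rho x == Some a & rho y == Some b] ==> (a <= b)].
Definition antitone rho : bool :=
  [forall x : 'I_n, forall y : 'I_n, forall a : 'I_n, forall b : 'I_n,
    [&& x <= y, rho x == Some a & rho y == Some b] ==> (b <= a)].
Definition monotone rho : bool := isotone rho || antitone rho.
Definition decreasing rho : bool :=
  [forall x : 'I_n, forall a : 'I_n, (rho x == Some a) ==> (a <= x)].

(* The classes of {(x, y) in Dom rho x Dom rho : x rho = y rho}. *)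
Definition ker_classes rho : {set {set 'I_n}} :=
  equivalence_partition (fun x y => rho x == rho y) (Dom rho).

(* rho is written as the array with columns (A i, a i), i < q: the A i are the
   kernel classes of rho in increasing order, and A i is mapped to a i. *)
Definition two_line rho (q : nat) (A : 'I_q -> {set 'I_n}) (a : 'I_q -> 'I_n)
    : Prop :=
  [/\ [set A i | i : 'I_q] = ker_classes rho,
      (forall i j : 'I_q, i < j ->
         forall x y, x \in A i -> y \in A j -> x < y)
    & forall (i : 'I_q) x, x \in A i -> rho x = Some (a i)].

(* The minimum of A; it is None only if A is empty. *)
Definition setmin A : option 'I_n := [pick m in A | [forall x in A, m <= x]].

Lemma isotoneP rho :
  reflect (forall x y a b, x <= y -> rho x = Some a -> rho y = Some b -> a <= b)
          (isotone rho).
Proof.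
apply: (iffP idP) => [/forallP h x y a b xy rx ry|h].
  move/forallP/(_ y)/forallP/(_ a)/forallP/(_ b)/implyP: (h x); apply.
  by rewrite xy rx ry !eqxx.
apply/forallP=> x; apply/forallP=> y; apply/forallP=> a; apply/forallP=> b.
by apply/implyP=> /and3P[xy /eqP rx /eqP ry]; apply: h rx ry.
Qed.

Lemma antitoneP rho :
  reflect (forall x y a b, x <= y -> rho x = Some a -> rho y = Some b -> b <= a)
          (antitone rho).
Proof.
apply: (iffP idP) => [/forallP h x y a b xy rx ry|h].
  move/forallP/(_ y)/forallP/(_ a)/forallP/(_ b)/implyP: (h x); apply.
  by rewrite xy rx ry !eqxx.
apply/forallP=> x; apply/forallP=> y; apply/forallP=> a; apply/forallP=> b.
by apply/implyP=> /and3P[xy /eqP rx /eqP ry]; apply: h rx ry.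
Qed.

Lemma decreasingP rho :
  reflect (forall x a, rho x = Some a -> a <= x) (decreasing rho).
Proof.
apply: (iffP idP) => [/forallP h x a rx|h].
  by move/forallP/(_ a)/implyP: (h x); apply; rewrite rx.
apply/forallP=> x; apply/forallP=> a.
by apply/implyP=> /eqP; apply: h.
Qed.

Lemma pcomp_Some rho sigma x b :
  pcomp rho sigma x = Some b -> exists2 a, rho x = Some a & sigma a = Some b.
Proof. by rewrite ffunE; case: (rho x) => //= a; exists a. Qed.

Lemma pcompA : associative pcomp.
Proof.
move=> r s t; apply/ffunP=> x; rewrite !ffunE.
by case: (r x) => //= a; rewrite ffunE.
Qed.

Lemma pcomp1f : left_id pid pcomp.
Proof. by move=> r; apply/ffunP=> x; rewrite !ffunE. Qed.

Lemma pcompf1 : right_id pid pcomp.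
Proof.
move=> r; apply/ffunP=> x; rewrite ffunE.
by case: (r x) => //= a; rewrite ffunE.
Qed.

Lemma monotone_pcomp rho sigma :
  monotone rho -> monotone sigma -> monotone (pcomp rho sigma).
Proof.
move=> /orP[/isotoneP hr|/antitoneP hr] /orP[/isotoneP hs|/antitoneP hs].
- apply/orP; left; apply/isotoneP=> x y a b xy /pcomp_Some[c rc sc].
  by move=> /pcomp_Some[d rd sd]; apply: hs sc sd; apply: hr rc rd.
- apply/orP; right; apply/antitoneP=> x y a b xy /pcomp_Some[c rc sc].
  by move=> /pcomp_Some[d rd sd]; apply: hs sc sd; apply: hr rc rd.
- apply/orP; right; apply/antitoneP=> x y a b xy /pcomp_Some[c rc sc].
  by move=> /pcomp_Some[d rd sd]; apply: hs sd sc; apply: hr rc rd.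
- apply/orP; left; apply/isotoneP=> x y a b xy /pcomp_Some[c rc sc].
  by move=> /pcomp_Some[d rd sd]; apply: hs sd sc; apply: hr rc rd.
Qed.

Lemma decreasing_pcomp rho sigma :
  decreasing rho -> decreasing sigma -> decreasing (pcomp rho sigma).
Proof.
move=> /decreasingP hr /decreasingP hs; apply/decreasingP=> x b.
by move=> /pcomp_Some[a ra sa]; apply: leq_trans (hs _ _ sa) (hr _ _ ra).
Qed.

Lemma pid_dorp : monotone pid && decreasing pid.
Proof.
apply/andP; split; last by apply/decreasingP=> x a; rewrite ffunE => -[->].
by apply/orP; left; apply/isotoneP=> x y a b xy; rewrite !ffunE => -[<-] [<-].
Qed.

Lemma height_pcompl rho sigma : height (pcomp rho sigma) <= height rho.
Proof.
pose f a := odflt a (sigma a).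
apply: leq_trans (leq_imset_card f (mem (Im rho))).
apply/subset_leq_card/subsetP=> b; rewrite inE => /existsP[x /eqP].
move=> /pcomp_Some[a ra sa]; apply/imsetP; exists a; last by rewrite /f sa.
by rewrite inE; apply/existsP; exists x; rewrite ra.
Qed.

Lemma height_pcompr rho sigma : height (pcomp rho sigma) <= height sigma.
Proof.
apply/subset_leq_card/subsetP=> b; rewrite !inE => /existsP[x /eqP].
by move=> /pcomp_Some[a _ sa]; apply/existsP; exists a; rewrite sa.
Qed.

Lemma ltn_enum_val (A : {set 'I_n}) (i j : 'I_(#|A|)) :
  i < j -> (enum_val i : 'I_n) < enum_val j.
Proof.
move=> ij; have x0 : 'I_n := enum_val i.
rewrite (enum_val_nth x0) (enum_val_nth x0 j).
have srt : sorted (fun x y : 'I_n => x < y) (enum A).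
  rewrite /enum_mem -enumT; apply: sorted_filter.
    by move=> y x z; apply: ltn_trans.
  by have := iota_ltn_sorted 0 n; rewrite -val_enum_ord sorted_map.
apply: (sorted_ltn_nth _ x0 srt) => //; last 2 first.
- by rewrite inE -cardE.
- by rewrite inE -cardE.
- by move=> y x z; apply: ltn_trans.
Qed.

Lemma fiber_ker_classes rho q (a : 'I_q -> 'I_n) :
    Im rho = [set a i | i : 'I_q] ->
  [set fiber rho (a i) | i : 'I_q] = ker_classes rho.
Proof.
move=> imE; have classE x b : rho x = Some b ->
    fiber rho b = [set y in Dom rho | rho x == rho y].
  by move=> rx; apply/setP=> y; rewrite !inE rx; case: (rho y).
apply/setP=> C; apply/imsetP/imsetP=> [[i _ ->]|[x xD ->]].
  have: a i \in Im rho by rewrite imE imset_f.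
  rewrite inE => /existsP[x /eqP rx]; exists x; last exact: classE.
  by rewrite inE rx.
case rx: (rho x) xD => [b|]; rewrite inE rx // => _.
have: b \in Im rho by rewrite inE; apply/existsP; exists x; rewrite rx.
by rewrite imE => /imsetP[i _ bE]; exists i => //; rewrite -bE (classE x) ?rx.
Qed.

Lemma two_line_exists rho :
  monotone rho ->
  exists (A : 'I_(height rho) -> {set 'I_n}) (a : 'I_(height rho) -> 'I_n),
    two_line rho A a.
Proof.
have imE : Im rho = [set enum_val i | i : 'I_(height rho)].
  apply/setP=> b; apply/idP/imsetP=> [bI|[i _ ->]]; last exact: enum_valP.
  by exists (enum_rank_in bI b); rewrite ?enum_rankK_in.
move=> /orP[/isotoneP h|/antitoneP h].
- pose a (i : 'I_(height rho)) : 'I_n := enum_val i.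
  exists (fun i => fiber rho (a i)), a; split; last 2 first.
  + move=> i j ij x y; rewrite !inE => /eqP rx /eqP ry; rewrite ltnNge.
    by apply/negP=> /h/(_ ry rx); rewrite leqNgt ltn_enum_val.
  + by move=> i x; rewrite inE => /eqP.
  exact: fiber_ker_classes.
- pose a (i : 'I_(height rho)) : 'I_n := enum_val (rev_ord i).
  exists (fun i => fiber rho (a i)), a; split; last 2 first.
  + move=> i j ij x y; rewrite !inE => /eqP rx /eqP ry; rewrite ltnNge.
    apply/negP=> /h/(_ ry rx); rewrite leqNgt ltn_enum_val //=.
    by apply: ltn_sub2l; rewrite ?ltnS // (leq_ltn_trans ij).
  + by move=> i x; rewrite inE => /eqP.
  apply: fiber_ker_classes; rewrite imE; apply/setP=> b.
  apply/imsetP/imsetP=> -[i _ ->]; exists (rev_ord i) => //.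
  by rewrite /a rev_ordK.
Qed.

End PartialTransformations.

Record DORP (n : nat) := MkDORP {
  dorp_val :> ptrans n;
  dorp_prop : monotone dorp_val && decreasing dorp_val }.

HB.instance Definition _ n := [isSub for @dorp_val n].
HB.instance Definition _ n := [Finite of DORP n by <:].

Section DORPMonoid.

Variable n : nat.
Implicit Types rho sigma : DORP n.

Lemma dorp_mul_subproof rho sigma :
  monotone (pcomp rho sigma) && decreasing (pcomp rho sigma).
Proof.
have /andP[mr dr] := dorp_prop rho; have /andP[ms ds] := dorp_prop sigma.
by rewrite monotone_pcomp ?decreasing_pcomp.
Qed.

Definition dorp_mul rho sigma : DORP n := MkDORP (dorp_mul_subproof rho sigma).
Definition dorp_one : DORP n := MkDORP (pid_dorp n).

Lemma dorp_mulA : associative dorp_mul.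
Proof. by move=> r s t; apply/val_inj/pcompA. Qed.

Lemma dorp_mul1g : left_id dorp_one dorp_mul.
Proof. by move=> r; apply/val_inj/pcomp1f. Qed.

Lemma dorp_mulg1 : right_id dorp_one dorp_mul.
Proof. by move=> r; apply/val_inj/pcompf1. Qed.

HB.instance Definition _ := isSemigroup.Build (DORP n) dorp_mulA.
HB.instance Definition _ :=
  Semigroup_isMonoid.Build (DORP n) dorp_mul1g dorp_mulg1.

Lemma height_mull rho sigma : height (rho * sigma) <= height rho.
Proof. exact: height_pcompl. Qed.

Lemma height_mulr rho sigma : height (rho * sigma) <= height sigma.
Proof. exact: height_pcompr. Qed.

End DORPMonoid.

(* The ideal I(n, p) of DORP n, as a semigroup. *)
Record Idl (n p : nat) := MkIdl {
  idl_val :> DORP n;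
  idl_prop : height idl_val <= p }.

HB.instance Definition _ n p := [isSub for @idl_val n p].
HB.instance Definition _ n p := [Finite of Idl n p by <:].

Section IdlSemigroup.

Variables n p : nat.
Implicit Types rho sigma : Idl n p.

Lemma idl_mul_subproof rho sigma :
  height ((rho : DORP n) * (sigma : DORP n)) <= p.
Proof. exact: leq_trans (height_mull _ _) (idl_prop rho). Qed.

Definition idl_mul rho sigma : Idl n p := MkIdl (idl_mul_subproof rho sigma).

Lemma idl_mulA : associative idl_mul.
Proof. by move=> r s t; apply/val_inj/mulgA. Qed.

HB.instance Definition _ := isSemigroup.Build (Idl n p) idl_mulA.

End IdlSemigroup.

(* The elements of DORP n of height exactly p. *)
Record Layer (n p : nat) := MkLayer {
  layer_val :> DORP n;
  layer_prop : height layer_val == p }.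

HB.instance Definition _ n p := [isSub for @layer_val n p].
HB.instance Definition _ n p := [Finite of Layer n p by <:].

(* The Rees quotient I(n, p) / I(n, p - 1) for p >= 1, with zero None. *)
Definition RQ (n p : nat) := option (Layer n p).

HB.instance Definition _ n p := Finite.on (RQ n p).

Section RQSemigroup.

Variables n p : nat.
Implicit Types (rho sigma : Layer n p) (x y z : RQ n p).

Definition RQelt rho : RQ n p := Some rho.

(* insub returns None when the composite does not have height p. *)
Definition rq_mul x y : RQ n p :=
  match x, y with
  | Some rho, Some sigma => insub ((rho : DORP n) * (sigma : DORP n))
  | _, _ => None
  end.

Lemma rq_mulA : associative rq_mul.
Proof.
move=> [r|] [s|] [t|] //=; last by case: insubP.
set rd := layer_val r; set sd := layer_val s; set td := layer_val t.
have ge_p (u v : DORP n) : height (u * v) = p ->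
    height u <= p -> height v <= p -> height u = p /\ height v = p.
  move=> uv hu hv; split; apply/eqP; rewrite eqn_leq.
  - by rewrite hu -uv height_mull.
  - by rewrite hv -uv height_mulr.
have hr : height rd = p by apply/eqP/layer_prop.
have ht : height td = p by apply/eqP/layer_prop.
have hst : height (sd * td) <= p by rewrite -ht height_mulr.
have hrs : height (rd * sd) <= p by rewrite -hr height_mull.
have [/eqP h|h] := boolP (height (rd * sd * td) == p).
  have [/eqP h1 _] := ge_p _ _ h hrs (eq_leq ht).
  have := h; rewrite -mulgA => /ge_p/(_ (eq_leq hr) hst)[_ /eqP h2].
  by rewrite (insubT (fun u : DORP n => height u == p) h1)
             (insubT (fun u : DORP n => height u == p) h2) /= mulgA.
transitivity (None : RQ n p); [|symmetry].
  by case: insubP => //= u _ ->; rewrite insubN // mulgA.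
by case: insubP => //= u _ ->; rewrite insubN.
Qed.

HB.instance Definition _ := isSemigroup.Build (RQ n p) rq_mulA.

End RQSemigroup.

(* Main.v *)
(* A left divisor is decreasing, so [rho = tau * sigma] forces the least element
   of each fibre of [sigma] below that of [rho]; L-related maps thus have equal
   fibre minima. Conversely, if the minima agree, sending every point of [Dom rho]
   to the least element of its kernel class gives a left divisor [tau] with
   [rho = tau * sigma], of the same height as [rho]. Right divisors are decreasing
   as well, so R-related maps lie pointwise below each other and are equal.
   Finally [rho = rho * tau * rho] forces [rho] to fix every point of its image,
   which fails for the shift [x |-> x - 1] on [{2, ..., p + 1}]. *)
From mathcomp Require Import all_boot.
From Stdlib Require Import Relation_Operators.
Require Import Defs.

Set Implicit Arguments.
Unset Strict Implicit.
Unset Printing Implicit Defensive.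

(** * Green's relations in an R-trivial semigroup *)

Section Green.

Variable S : semigroupType.
Implicit Types x y z : S.

Lemma in_lideal_trans x y z : in_lideal x y -> in_lideal y z -> in_lideal x z.
Proof.
move=> [->|[s ->]] // [->|[t ->]]; right; first by exists s.
by exists (t * s)%g; rewrite mulgA.
Qed.

Lemma in_rideal_trans x y z : in_rideal x y -> in_rideal y z -> in_rideal x z.
Proof.
move=> [->|[s ->]] // [->|[t ->]]; right; first by exists s.
by exists (s * t)%g; rewrite mulgA.
Qed.

Lemma greenLP x y : greenL x y <-> in_lideal y x /\ in_lideal x y.
Proof.
split=> [xy|[yx xy] z]; last by split; apply: in_lideal_trans.
by split; [apply/(xy x)|apply/(xy y)]; left.
Qed.

Lemma greenRP x y : greenR x y <-> in_rideal y x /\ in_rideal x y.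
Proof.
split=> [xy|[yx xy] z]; last by split; apply: in_rideal_trans.
by split; [apply/(xy x)|apply/(xy y)]; left.
Qed.

Hypothesis R_trivial : forall x y, greenR x y -> x = y.

Lemma R_trivial_R_eq x y : greenR x y <-> x = y.
Proof. by split=> [/R_trivial|->]. Qed.

(** When R is equality, every generating step of the join is an L-step, and L is already an
    equivalence. *)
Lemma R_trivial_L_D x y : greenL x y <-> greenD x y.
Proof.
split=> [xy|]; first by apply: rst_step; left.
elim=> {x y} [x y [//|/R_trivial-> //]|x //|x y _ xy z|x y z _ xy _ yz w].
  by split=> /xy.
by split=> [/xy/yz|/yz/xy].
Qed.

Lemma R_trivial_R_H x y : greenR x y <-> greenH x y.
Proof. by split=> [xy|[]//]; split=> //; rewrite (R_trivial xy). Qed.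

End Green.

(** A finite set has only one strictly sorted enumeration. This later aligns the indexing of two
    arrays. *)
Lemma increasing_enum_uniq (q n : nat) (f g : 'I_q -> 'I_n) :
    {homo f : i j / i < j} -> {homo g : i j / i < j} ->
    (forall i, exists j, f i = g j) -> (forall j, exists i, g j = f i) ->
  f =1 g.
Proof.
move=> incf incg fg gf.
have srt (h : 'I_q -> 'I_n) : {homo h : i j / i < j} ->
    sorted (fun x y : 'I_n => x < y) (map h (enum 'I_q)).
  move=> inch; apply: (homo_sorted (e := fun i j : 'I_q => i < j)) => //.
  by have := iota_ltn_sorted 0 q; rewrite -val_enum_ord sorted_map.
have eq_map : map f (enum 'I_q) = map g (enum 'I_q).
  apply: irr_sorted_eq (srt f incf) (srt g incg) _.
  - by move=> y x z; apply: ltn_trans.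
  - by move=> x; apply: ltnn.
  move=> x; apply/mapP/mapP=> -[i _ ->].
    by have [j ->] := fg i; exists j; rewrite ?mem_enum.
  by have [j ->] := gf i; exists j; rewrite ?mem_enum.
by move: eq_map => /eq_in_map fgE i; apply: fgE; rewrite mem_enum.
Qed.

(** * Fibre minima and left factors *)

Section PartialTransformations.

Variable n : nat.
Implicit Types (rho sigma tau : ptrans n) (x y a b m : 'I_n) (A : {set 'I_n}).

Lemma setminP A m :
  setmin A = Some m <-> m \in A /\ (forall x, x \in A -> m <= x).
Proof.
rewrite /setmin; split.
  by case: pickP => // k /andP[kA /forall_inP kmin] [<-].
move=> [mA mmin]; case: pickP => [k /andP[kA /forall_inP kmin]|/(_ m)].
  by congr Some; apply/val_inj/eqP; rewrite eqn_leq kmin // mmin.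
by rewrite mA /= => /negP[]; apply/forall_inP.
Qed.

Lemma setmin_exists A x : x \in A -> exists m, setmin A = Some m.
Proof.
move=> xA; case: (arg_minnP (fun y : 'I_n => y : nat) xA) => m mA mmin.
by exists m; apply/setminP.
Qed.

Lemma fiberP rho a x : reflect (rho x = Some a) (x \in fiber rho a).
Proof. by rewrite inE; apply: eqP. Qed.

Lemma setmin_fiber rho a m : setmin (fiber rho a) = Some m -> rho m = Some a.
Proof. by move=> /setminP[/fiberP]. Qed.

(** Index-free form of the condition in (a): an empty fibre gives [None], so the images are compared
    as well. *)
Definition fiber_min_eq rho sigma : Prop :=
  forall a, setmin (fiber rho a) = setmin (fiber sigma a).

(** What [rho = tau * sigma] implies for a decreasing [tau], phrased without [tau] and without
    minima. *)
Definition fiber_below rho sigma : Prop :=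
  forall x a, rho x = Some a -> exists2 y : 'I_n, y <= x & sigma y = Some a.

Lemma fiber_below_refl rho : fiber_below rho rho.
Proof. by move=> x a; exists x. Qed.

Lemma fiber_below_pcomp tau sigma :
  decreasing tau -> fiber_below (pcomp tau sigma) sigma.
Proof.
by move=> /decreasingP dt x a /pcomp_Some[y ty sy]; exists y => //; apply: dt.
Qed.

(** If [m] is least in a fibre of [rho], the fibre of [sigma] contains some [y <= m], while each of
    its points lies above a point of the fibre of [rho], hence above [m]; so [y = m]. *)
Lemma fiber_below_min rho sigma :
  fiber_below rho sigma -> fiber_below sigma rho -> fiber_min_eq rho sigma.
Proof.
have half r s a m : fiber_below r s -> fiber_below s r ->
    setmin (fiber r a) = Some m -> setmin (fiber s a) = Some m.
  move=> rs sr /setminP[/fiberP rm mmin].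
  have le_m x : s x = Some a -> m <= x.
    by move=> /sr[y yx /fiberP/mmin my]; apply: leq_trans my yx.
  apply/setminP; split=> [|x /fiberP/le_m//]; apply/fiberP.
  have [y ym sy] := rs _ _ rm; suff -> : m = y by [].
  by apply/val_inj/eqP; rewrite eqn_leq ym (le_m _ sy).
move=> rs sr a; case E: (setmin (fiber rho a)) => [m|].
  by rewrite (half _ _ _ _ rs sr E).
case F: (setmin (fiber sigma a)) => [m|//].
by rewrite (half _ _ _ _ sr rs F) in E.
Qed.

(** The minimum is taken in the fibre of [sigma], so that [sigma] sends it back to the value of
    [rho]. *)
Definition to_fiber_min rho sigma : ptrans n :=
  pcomp rho [ffun a => setmin (fiber sigma a)].

Lemma to_fiber_minP rho sigma x m :
    fiber_min_eq rho sigma -> to_fiber_min rho sigma x = Some m ->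
  exists2 a, rho x = Some a & setmin (fiber rho a) = Some m.
Proof. by move=> E /pcomp_Some[a ra]; rewrite ffunE -E; exists a. Qed.

Lemma to_fiber_minK rho sigma :
  fiber_min_eq rho sigma -> pcomp (to_fiber_min rho sigma) sigma = rho.
Proof.
move=> E; apply/ffunP=> x; rewrite !ffunE; case rx: (rho x) => [a|//] /=.
have [m mE] := setmin_exists (introT (fiberP rho a x) rx).
by rewrite ffunE -E mE /=; apply: setmin_fiber; rewrite -E.
Qed.

Lemma to_fiber_min_decreasing rho sigma :
  fiber_min_eq rho sigma -> decreasing (to_fiber_min rho sigma).
Proof.
move=> E; apply/decreasingP=> x m /(to_fiber_minP E)[a rx /setminP[_]].
by apply; apply/fiberP.
Qed.

(** The factor is isotone even for antitone [rho]: if [x <= y] had minima in reversed order,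
    monotonicity of [rho] on both pairs would give [a <= b] and [b <= a], hence equal minima. *)
Lemma to_fiber_min_monotone rho sigma :
  fiber_min_eq rho sigma -> monotone rho -> monotone (to_fiber_min rho sigma).
Proof.
move=> E mon; apply/orP; left; apply/isotoneP=> x y k l xy.
move=> /(to_fiber_minP E)[a rx kE] /(to_fiber_minP E)[b ry lE].
rewrite leqNgt; apply/negP=> /[dup] lk /ltnW le_lk.
have [rk rl] := (setmin_fiber kE, setmin_fiber lE).
suff ab : a = b by move: lk; rewrite ab lE in kE; case: kE => ->; rewrite ltnn.
apply/val_inj/eqP; rewrite eqn_leq.
case/orP: mon => [/isotoneP h|/antitoneP h].
  by rewrite (h _ _ _ _ xy rx ry) (h _ _ _ _ le_lk rl rk).
by rewrite (h _ _ _ _ xy rx ry) (h _ _ _ _ le_lk rl rk).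
Qed.

(** Each of [rho] and the factor is a composite starting with the other, and composition never
    raises height. *)
Lemma height_to_fiber_min rho sigma :
  fiber_min_eq rho sigma -> height (to_fiber_min rho sigma) = height rho.
Proof.
move=> E; apply/eqP; rewrite eqn_leq height_pcompl /=.
by rewrite -{1}(to_fiber_minK E) height_pcompl.
Qed.

(** * Two-line notation in terms of fibres *)

Lemma two_line_fiber rho q (A : 'I_q -> {set 'I_n}) (a : 'I_q -> 'I_n) i :
  two_line rho A a -> A i = fiber rho (a i).
Proof.
move=> [kerE _ val]; have: A i \in ker_classes rho by rewrite -kerE imset_f.
move=> /imsetP[x xD Ai]; have rx : rho x = Some (a i).
  by apply: val; rewrite Ai inE xD eqxx.
by apply/setP=> y; rewrite Ai !inE rx [RHS]eq_sym; case: (rho y).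
Qed.

Lemma two_line_value rho q (A : 'I_q -> {set 'I_n}) (a : 'I_q -> 'I_n) x c :
  two_line rho A a -> rho x = Some c -> exists i, c = a i.
Proof.
move=> [kerE _ val] rx; have xD : x \in Dom rho by rewrite inE rx.
have: [set y in Dom rho | rho x == rho y] \in ker_classes rho by apply: imset_f.
rewrite -kerE => /imsetP[i _ Ai]; exists i.
by have: x \in A i by [rewrite -Ai inE xD eqxx]; move=> /val; rewrite rx => -[].
Qed.

Lemma two_line_min rho q (A : 'I_q -> {set 'I_n}) (a : 'I_q -> 'I_n) :
    two_line rho A a ->
  exists2 m : 'I_q -> 'I_n, {homo m : i j / i < j}
    & forall i, setmin (fiber rho (a i)) = Some (m i).
Proof.
move=> tl; have [kerE inc _] := tl.
have minE i : exists m, setmin (fiber rho (a i)) = Some m.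
  have: A i \in ker_classes rho by rewrite -kerE imset_f.
  move=> /imsetP[x xD Ai]; apply: (@setmin_exists _ x).
  by rewrite -(two_line_fiber i tl) Ai inE xD eqxx.
have mP i : exists m, setmin (fiber rho (a i)) == Some m.
  by have [m ->] := minE i; exists m.
exists (fun i => xchoose (mP i)) => [i j ij|i]; last exact/eqP/(xchooseP (mP i)).
by apply: inc ij _ _ _ _; rewrite (two_line_fiber _ tl);
  apply/fiberP/setmin_fiber/eqP/(xchooseP (mP _)).
Qed.

(* The fibre minima list the kernel classes in increasing order, so they
   determine the indexing and hence the second row of the array. *)
Lemma two_line_fiber_min_eq rho sigma q
    (A : 'I_q -> {set 'I_n}) (a : 'I_q -> 'I_n)
    (B : 'I_q -> {set 'I_n}) (b : 'I_q -> 'I_n) :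
    two_line rho A a -> two_line sigma B b ->
  (fiber_min_eq rho sigma <->
   forall i, a i = b i /\
     setmin (fiber rho (a i)) = setmin (fiber sigma (b i))).
Proof.
move=> tlr tls; split=> [E|E c]; last first.
  have [/existsP[x /fiberP rx]|] := boolP [exists x, x \in fiber rho c].
    have [i ->] := two_line_value tlr rx.
    by have [ab ->] := E i; rewrite ab.
  (* Here [c] is not a value of [rho]. Were it a value of [sigma], it would be some [b i = a i], and
     the equal minima would put a point in the empty fibre. *)
  rewrite negb_exists => /forallP r0; rewrite /setmin.
  case: pickP => [x /andP[xr]|_]; first by have := r0 x; rewrite xr.
  case: pickP => [x /andP[/fiberP sx]|//] _.
  have [i cE] := two_line_value tls sx; have [ab mE] := E i.
  have [m mEs] := setmin_exists (introT (fiberP sigma c x) sx).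
  move: mE; rewrite ab -cE mEs => /setmin_fiber/fiberP.
  by rewrite (negbTE (r0 m)).
have [m incm mE] := two_line_min tlr; have [k inck kE] := two_line_min tls.
have mk : m =1 k.
  apply: increasing_enum_uniq => // i.
    have := mE i; rewrite E => /[dup] /setmin_fiber /(two_line_value tls)[j ->].
    by rewrite kE => -[<-]; exists j.
  have := kE i; rewrite -E => /[dup] /setmin_fiber /(two_line_value tlr)[j ->].
  by rewrite mE => -[<-]; exists j.
(* At the common minimum [k i], [sigma] takes both values [a i] and [b i]. *)
move=> i; suff ab : a i = b i by rewrite E ab.
have := mE i; rewrite E mk => /setmin_fiber.
by rewrite (setmin_fiber (kE i)) => -[].
Qed.

(** * Pointwise order, including inclusion of domains, and regularity *)

Definition pointwise_below rho sigma : Prop :=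
  forall x a, rho x = Some a -> exists2 b : 'I_n, sigma x = Some b & a <= b.

Lemma pointwise_below_refl rho : pointwise_below rho rho.
Proof. by move=> x a; exists a. Qed.

Lemma pointwise_below_pcomp sigma tau :
  decreasing tau -> pointwise_below (pcomp sigma tau) sigma.
Proof.
by move=> /decreasingP dt x a /pcomp_Some[b sb /dt ab]; exists b.
Qed.

Lemma pointwise_below_anti rho sigma :
  pointwise_below rho sigma -> pointwise_below sigma rho -> rho = sigma.
Proof.
move=> rs sr; apply/ffunP=> x; case rx: (rho x) => [a|].
  have [b sx ab] := rs _ _ rx; have [c] := sr _ _ sx.
  rewrite rx sx => -[<-] ba; suff -> : a = b by [].
  by apply/val_inj/eqP; rewrite eqn_leq ab.
by case sx: (sigma x) => [b|//]; have [c] := sr _ _ sx; rewrite rx.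
Qed.

(** Here [tau] sends [a] to some [b] with [rho b = Some a]; both maps being decreasing,
    [b <= a <= b]. *)
Lemma regular_fixes_image rho tau x a :
    decreasing rho -> decreasing tau -> rho = pcomp (pcomp rho tau) rho ->
  rho x = Some a -> rho a = Some a.
Proof.
move=> /decreasingP dr /decreasingP dt E rx; have := rx.
rewrite {1}E => /pcomp_Some[b /pcomp_Some[c]]; rewrite rx => -[<-] tb rb.
have ba : b = a.
  by apply/val_inj/eqP; rewrite eqn_leq (dt _ _ tb) (dr _ _ rb).
by rewrite ba in rb.
Qed.

End PartialTransformations.

(** * Left factors and the shift inside [DORP n] *)

Section DORPFacts.

Variable n : nat.
Implicit Types rho sigma tau : DORP n.

Lemma dorp_monotone rho : monotone rho.
Proof. by case/andP: (dorp_prop rho). Qed.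

Lemma dorp_decreasing rho : decreasing rho.
Proof. by case/andP: (dorp_prop rho). Qed.

Lemma fiber_min_left_factor rho sigma :
    fiber_min_eq rho sigma ->
  exists2 tau, rho = (tau * sigma)%g & height tau = height rho.
Proof.
move=> E; have P : monotone (to_fiber_min rho sigma) &&
    decreasing (to_fiber_min rho sigma).
  by rewrite to_fiber_min_monotone ?to_fiber_min_decreasing ?dorp_monotone.
exists (MkDORP P); last exact: height_to_fiber_min.
by apply/val_inj; rewrite /= to_fiber_minK.
Qed.

(** With the chain starting at 0, the domain is [{1, ..., p}] and the image [{0, ..., p-1}]; [insub]
    only repackages the predecessor, which is always below [n]. *)
Definition shift_fun p : ptrans n :=
  [ffun x : 'I_n => if 0 < x <= p then insub x.-1 else None].

Lemma shift_subproof p : monotone (shift_fun p) && decreasing (shift_fun p).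
Proof.
have sP x a : shift_fun p x = Some a -> a = x.-1 :> nat.
  by rewrite ffunE; case: ifP => // _; case: insubP => // b _ <- [->].
apply/andP; split; last first.
  by apply/decreasingP=> x a /sP->; apply: leq_pred.
apply/orP; left; apply/isotoneP=> x y a b xy /sP-> /sP->.
by rewrite -!subn1 leq_sub2r.
Qed.

Definition shift p : DORP n := MkDORP (shift_subproof p).

Lemma shiftE p (x : 'I_n) (i : 'I_n) :
  i < p -> x = i.+1 :> nat -> shift_fun p x = Some i.
Proof.
move=> ip xi; rewrite ffunE xi ltnS leq0n ip /= insubT //= => ilt.
by congr Some; apply: val_inj.
Qed.

Lemma height_shift p : p < n -> height (shift p) = p.
Proof.
move=> pn; have inj : injective (widen_ord (ltnW pn)).
  by move=> i j /(congr1 val) /= ij; apply: val_inj.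
rewrite -[RHS]card_ord -(card_imset _ inj).
apply: eq_card => a; rewrite inE; apply/existsP/imsetP.
  move=> [x]; rewrite ffunE; case: ifP => // /andP[x0 xp].
  case: insubP => // b _ bE /eqP[ab].
  have ap : a < p by rewrite -ab bE prednK.
  by exists (Ordinal ap) => //; apply: val_inj.
move=> [i _ ->]; have ip := ltn_ord i.
exists (Ordinal (leq_ltn_trans ip pn)).
by apply/eqP/shiftE.
Qed.

(** The image point 0 would have to be fixed, but it lies outside the domain. *)
Lemma shift_nonregular p tau :
  0 < p -> p < n -> shift p <> (shift p * tau * shift p)%g.
Proof.
move=> p0 pn /(congr1 (@dorp_val n)) E.
pose one := Ordinal (leq_ltn_trans p0 pn).
pose zero := Ordinal (leq_ltn_trans (leq0n p) pn).
have s1 : shift_fun p one = Some zero by apply: shiftE.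
have := regular_fixes_image (dorp_decreasing _) (dorp_decreasing tau) E s1.
by rewrite ffunE.
Qed.

End DORPFacts.

(** * The ideal [I(n, p)] *)

Section IdlFacts.

Variables n p : nat.
Implicit Types rho sigma : Idl n p.

Lemma idl_lideal_below rho sigma :
  in_lideal sigma rho -> fiber_below rho sigma.
Proof.
move=> [->|[tau ->]]; first exact: fiber_below_refl.
exact/fiber_below_pcomp/dorp_decreasing.
Qed.

Lemma idl_rideal_below rho sigma :
  in_rideal sigma rho -> pointwise_below rho sigma.
Proof.
move=> [->|[tau ->]]; first exact: pointwise_below_refl.
exact/pointwise_below_pcomp/dorp_decreasing.
Qed.

Lemma idl_fiber_min_lideal rho sigma :
  fiber_min_eq rho sigma -> in_lideal sigma rho.
Proof.
move=> /fiber_min_left_factor[tau E hE]; right.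
(* Preservation of height keeps the left factor inside the ideal. *)
have tau_p : height tau <= p by rewrite hE idl_prop.
by exists (MkIdl tau_p); apply: val_inj.
Qed.

Lemma idl_greenL rho sigma : greenL rho sigma <-> fiber_min_eq rho sigma.
Proof.
split=> [/greenLP[/idl_lideal_below rs /idl_lideal_below sr]|E].
  exact: fiber_below_min.
by apply/greenLP; split; apply: idl_fiber_min_lideal => // a; rewrite E.
Qed.

Lemma idl_R_trivial rho sigma : greenR rho sigma -> rho = sigma.
Proof.
move=> /greenRP[/idl_rideal_below rs /idl_rideal_below sr].
exact/val_inj/val_inj/pointwise_below_anti.
Qed.

Lemma idl_nonregular : 0 < p -> p < n -> ~ regular (Idl n p).
Proof.
move=> p0 pn; have sp : height (shift n p) <= p by rewrite height_shift.
move=> /(_ (MkIdl sp))[tau /(congr1 (@idl_val n p))].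
exact: shift_nonregular.
Qed.

End IdlFacts.

(** * The Rees quotient *)

Section RQFacts.

Variables n p : nat.
Implicit Types (rho sigma tau : Layer n p) (x y : RQ n p).

(** Settles the zero cases once, reducing nonzero products to composites in [DORP n]. *)
Lemma rq_mul_SomeP x y rho :
  (x * y)%g = RQelt rho <->
  exists sigma tau, [/\ x = RQelt sigma, y = RQelt tau
    & rho = ((sigma : DORP n) * (tau : DORP n))%g :> DORP n].
Proof.
split=> [|[sigma [tau [-> -> E]]]]; last first.
  by rewrite /mul /= -E; exact: (valK rho).
case: x y => [s|] [t|] //.
by rewrite /mul /= /RQelt; case: insubP => // u _ uE [<-]; exists s, t.
Qed.

Lemma rq_lideal_below rho sigma :
  in_lideal (RQelt sigma) (RQelt rho) -> fiber_below rho sigma.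
Proof.
move=> [[->]|[x /esym/rq_mul_SomeP[tau [_ [_ [<-] ->]]]]].
  exact: fiber_below_refl.
exact/fiber_below_pcomp/dorp_decreasing.
Qed.

Lemma rq_rideal_below rho sigma :
  in_rideal (RQelt sigma) (RQelt rho) -> pointwise_below rho sigma.
Proof.
move=> [[->]|[x /esym/rq_mul_SomeP[_ [tau [[<-] _ ->]]]]].
  exact: pointwise_below_refl.
exact/pointwise_below_pcomp/dorp_decreasing.
Qed.

Lemma rq_fiber_min_lideal rho sigma :
  fiber_min_eq rho sigma -> in_lideal (RQelt sigma) (RQelt rho).
Proof.
move=> /fiber_min_left_factor[tau E hE]; right.
(* The factor has height exactly [p], so it is a nonzero element of the quotient. *)
have tau_p : height tau == p by rewrite hE layer_prop.
exists (RQelt (MkLayer tau_p)); apply/esym/rq_mul_SomeP.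
by exists (MkLayer tau_p), sigma.
Qed.

Lemma rq_greenL rho sigma :
  greenL (RQelt rho) (RQelt sigma) <-> fiber_min_eq rho sigma.
Proof.
split=> [/greenLP[/rq_lideal_below rs /rq_lideal_below sr]|E].
  exact: fiber_below_min.
by apply/greenLP; split; apply: rq_fiber_min_lideal => // a; rewrite E.
Qed.

(** Isolates the zero as an R-class of its own. *)
Lemma rq_zero_rideal x : in_rideal (None : RQ n p) x -> x = None.
Proof. by move=> [//|[y ->]]. Qed.

Lemma rq_R_trivial x y : greenR x y -> x = y.
Proof.
move=> /greenRP; case: x y => [r|] [s|] [] //.
- move=> /rq_rideal_below rs /rq_rideal_below sr; congr Some.
  exact/val_inj/val_inj/pointwise_below_anti.
- by move=> /rq_zero_rideal.
- by move=> _ /rq_zero_rideal.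
Qed.

Lemma rq_nonregular : 0 < p -> p < n -> ~ regular (RQ n p).
Proof.
move=> p0 pn; have sp : height (shift n p) == p by rewrite height_shift.
move=> /(_ (RQelt (MkLayer sp)))[y /esym/rq_mul_SomeP[u [v [uE [<-] E]]]].
(* A nonzero triple product has nonzero partial products, so [y] comes from a map [t]. *)
have /rq_mul_SomeP[s [t [[sE] _ uE']]] := uE.
by move: E; rewrite uE' -sE; apply: shift_nonregular.
Qed.

End RQFacts.

Theorem theorem2p6 (n p : nat) (hp1 : 1 <= p) (hpn : p <= n - 1) :
  (* S = RQ_p(n) *)
  [/\ forall (rho sigma : Layer n p)
             (A : 'I_p -> {set 'I_n}) (a : 'I_p -> 'I_n)
             (B : 'I_p -> {set 'I_n}) (b : 'I_p -> 'I_n),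
        two_line rho A a -> two_line sigma B b ->
        (greenL (RQelt rho) (RQelt sigma) <->
         forall i, a i = b i /\
           setmin (fiber rho (a i)) = setmin (fiber sigma (b i))),
      forall x y : RQ n p, greenR x y <-> x = y,
      forall x y : RQ n p, greenL x y <-> greenD x y,
      forall x y : RQ n p, greenR x y <-> greenH x y
    & 2 <= p -> ~ regular (RQ n p)]
  /\
  (* S = I(n, p) *)
  [/\ forall (q : nat) (hq : 1 <= q) (rho sigma : Idl n p)
             (A : 'I_q -> {set 'I_n}) (a : 'I_q -> 'I_n)
             (B : 'I_q -> {set 'I_n}) (b : 'I_q -> 'I_n),
        height rho = q -> height sigma = q ->
        two_line rho A a -> two_line sigma B b ->
        (greenL rho sigma <->
         forall i, a i = b i /\
           setmin (fiber rho (a i)) = setmin (fiber sigma (b i))),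
      forall x y : Idl n p, greenR x y <-> x = y,
      forall x y : Idl n p, greenL x y <-> greenD x y,
      forall x y : Idl n p, greenR x y <-> greenH x y
    & 2 <= p -> ~ regular (Idl n p)].
Proof.
(* Subtraction is truncated: [1 <= p] excludes [n = 0]. *)
have pn : p < n by case: n hpn => [|m]; rewrite ?subn1 //; case: p hp1.
split; split.
- move=> rho sigma A a B b tlr tls.
  exact: iff_trans (rq_greenL _ _) (two_line_fiber_min_eq tlr tls).
- exact/R_trivial_R_eq/rq_R_trivial.
- exact/R_trivial_L_D/rq_R_trivial.
- exact/R_trivial_R_H/rq_R_trivial.
- by move=> _; apply: rq_nonregular.
- move=> q _ rho sigma A a B b _ _ tlr tls.
  exact: iff_trans (idl_greenL _ _) (two_line_fiber_min_eq tlr tls).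
- exact/R_trivial_R_eq/idl_R_trivial.
- exact/R_trivial_L_D/idl_R_trivial.
- exact/R_trivial_R_H/idl_R_trivial.
- by move=> _; apply: idl_nonregular.
Qed.
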